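(* Let $G$ be a finite group, let $I$ and $\Lambda$ be finite (non-empty) index sets, and let $P=(p_{\lambda i})$ be a regular $\Lambda\times I$ matrix with entries in $G^0$ that contains at least one zero entry. Let $$A=\begin{bmatrix}0&0&\times&\times\\ \times&\times&0&0\end{bmatrix},\qquad B=\begin{bmatrix}0&0&\times\\ \times&0&0\end{bmatrix},$$ and let $\Gamma=\mathcal{G}(\mathcal{M}_0[G;I,\Lambda;P])$. (1) Suppose that $|G|\geqslant 3$. Then $\Gamma$ contains cycles and $\mathrm{girth}(\Gamma)=3$. (2) Suppose that $|G|=2$. Then $\Gamma$ contains cycles if and only if $P$ contains more than one zero entry, in which case $\mathrm{girth}(\Gamma)=3$. (3) Suppose that $|G|=1$. Then $\Gamma$ contains cycles if and only if at least one of the matrices $D_3$, $O_{1\times 3}$, $O_{3\times 1}$, $O_{2\times 2}$, $A$, $A^T$, $B$ or $B^T$ is a $\leftrightarrow$-submatrix of $\overline{P}$. Furthermore, (a) if at least one of the matrices $D_3$, $O_{1\times 3}$, $O_{3\times 1}$ or $O_{2\times 2}$ is a $\leftrightarrow$-submatrix of $\overline{P}$, then $\mathrm{girth}(\Gamma)=3$; (b) if at least one of the matrices $A$, $A^T$, $B$ or $B^T$ is a $\leftrightarrow$-submatrix of $\overline{P}$ and $D_3$, $O_{1\times 3}$, $O_{3\times 1}$ and $O_{2\times 2}$ are not $\leftrightarrow$-submatrices of $\overline{P}$, then $\mathrm{girth}(\Gamma)=4$.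
   Context: $G^0=G\cup\{0\}$ is $G$ with a zero adjoined. A matrix over $G^0$ is regular if every row and every column contains a non-zero entry. The $0$-Rees matrix semigroup $\mathcal{M}_0[G;I,\Lambda;P]$ is the set $(I\times G\times\Lambda)\cup\{0\}$ with $(i,x,\lambda)(j,y,\mu)=(i,xp_{\lambda j}y,\mu)$ if $p_{\lambda j}\neq 0$, $(i,x,\lambda)(j,y,\mu)=0$ if $p_{\lambda j}=0$, and all products involving $0$ equal to $0$. The commuting graph $\mathcal{G}(S)$ of a finite non-commutative semigroup $S$ is the simple graph with vertex set $S\setminus Z(S)$ ($Z(S)$ the center), where distinct $x,y$ are adjacent iff $xy=yx$. (When $P$ is regular and has a zero entry, $\mathcal{M}_0[G;I,\Lambda;P]$ is non-commutative with center $\{0\}$.) The girth of a graph containing cycles is the length of a shortest cycle. $\overline{P}$ is the matrix obtained from $P$ by replacing each non-zero entry by the symbol $\times$. A matrix $Q$ is a $\leftrightarrow$-submatrix of a matrix $M$ if $Q$ can be obtained by permuting the rows and/or columns of a submatrix of $M$. $D_n$ is the $n\times n$ matrix with diagonal entries $\times$ and all other entries $0$. $O_{n\times m}$ is the $n\times m$ matrix all of whose entries are $0$. $T$ denotes transpose. *)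

(* Defs.v *)
From mathcomp Require Import all_boot all_fingroup all_algebra.

Set Implicit Arguments.
Unset Strict Implicit.
Unset Printing Implicit Defensive.

Import GroupScope.
Local Open Scope group_scope.

(* The library's [semigroupType] cannot be joined with [finType] outside the
   library: such a join would have to precede its finite group structures. *)
Record fin_semigroup := FinSemigroup {
  sg_sort :> finType;
  sg_mul : sg_sort -> sg_sort -> sg_sort;
  sg_mulA : associative sg_mul }.

Section CommutingGraph.
Variable S : fin_semigroup.
Local Notation "x * y" := (@sg_mul S x y).

Definition sg_center : {set S} := [set z | [forall x, z * x == x * z]].

Definition cg_vertex : finType := {x : S | x \notin sg_center}.

Definition commuting_graph : rel cg_vertex :=
  fun x y => (x != y) && (val x * val y == val y * val x).

Lemma commuting_graph_sym : symmetric commuting_graph.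
Proof. by move=> x y; rewrite /commuting_graph eq_sym [_ * _ == _]eq_sym. Qed.

Lemma commuting_graph_irrefl : irreflexive commuting_graph.
Proof. by move=> x; rewrite /commuting_graph eqxx. Qed.

End CommutingGraph.

Section Cycles.
Variables (V : finType) (e : rel V).

(* [ucycle] alone would also accept the empty sequence and a single edge
   traversed back and forth. *)
Definition graph_cycle (s : seq V) : Prop := ucycle e s /\ 2 < size s.

Definition contains_cycles : Prop := exists s, graph_cycle s.

Definition girth_eq (n : nat) : Prop :=
  (exists2 s, graph_cycle s & size s = n) /\
  (forall s, graph_cycle s -> n <= size s).

End Cycles.

(* A Lam x I matrix is a function Lam -> I -> _, with rows indexed by Lam.
   G^0 is [option gT], with zero [None]. *)
Section Rees.
Variables (gT : finGroupType) (I Lam : finType).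
Implicit Type P : Lam -> I -> option gT.

Definition regular_mx P : Prop :=
  (forall l, exists i, P l i != None) /\ (forall i, exists l, P l i != None).

Definition zero_entries P : {set Lam * I} := [set li | P li.1 li.2 == None].

(* [None] is the zero of the semigroup. *)
Definition rees0_mul P (u v : option (I * gT * Lam)) : option (I * gT * Lam) :=
  match u, v with
  | Some (i, x, l), Some (j, y, m) =>
      if P l j is Some p then Some (i, x * p * y, m) else None
  | _, _ => None
  end.

Lemma rees0_mulA P : associative (rees0_mul P).
Proof.
case=> [[[i x] l]|] [[[j y] m]|] [[[k z] n]|] //=.
- case Emk: (P m k) => [q|]; case Elj: (P l j) => [p|] //=;
    by rewrite ?Emk ?Elj // !mulgA.
- by case: (P l j).
Qed.

Definition rees0 P : fin_semigroup := FinSemigroup (rees0_mulA P).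

(* Matrices over {x, 0} are boolean matrices: [true] stands for the symbol x. *)
Definition mx_bar P : Lam -> I -> bool := fun l i => P l i != None.

(* A submatrix with its rows and columns permuted: [f] and [g] list the chosen
   distinct rows and columns in an arbitrary order. *)
Definition lr_submx k n (Q : 'M[bool]_(k, n)) (M : Lam -> I -> bool) : Prop :=
  exists (f : 'I_k -> Lam) (g : 'I_n -> I),
    [/\ injective f, injective g & forall a b, Q a b = M (f a) (g b)].

End Rees.

Definition D_mx n : 'M[bool]_n := \matrix_(i, j) (i == j).

Definition O_mx k n : 'M[bool]_(k, n) := const_mx false.

Definition A_mx : 'M[bool]_(2, 4) :=
  \matrix_(i, j) nth false
    (nth [::] [:: [:: false; false; true;  true ];
                  [:: true;  true;  false; false]] i) j.

Definition B_mx : 'M[bool]_(2, 3) :=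
  \matrix_(i, j) nth false
    (nth [::] [:: [:: false; false; true ];
                  [:: true;  false; false]] i) j.

(* Main.v *)
Require Import Defs.
From mathcomp Require Import all_boot all_fingroup all_algebra.

Set Implicit Arguments.
Unset Strict Implicit.
Unset Printing Implicit Defensive.

(* The non-central elements are exactly the non-zero ones, and (i, x, l),
   (j, y, m) commute iff p_{lj} = p_{mi} = 0, or they lie in the same cell
   (i = j, l = m) and x, y commute through p_{li}.  When |G| > 1 this yields the
   triangles directly, while with a single zero entry (and |G| = 2) all edges
   stay inside a cell, which has only two elements.

   For trivial G the vertices are the cells.  A triangle of cells is D_3, O_{1x3},
   O_{3x1} or O_{2x2}.  Two rows (or two columns) with two zeros each give a
   4-cycle, and in the absence of O_{1x3} and O_{2x2} such a pair of rows is
   precisely A or B.  Finally, a cell on a cycle has two neighbours, so its row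
   or its column has two zeros; without O_{1x3} and O_{3x1}, if at most one row
   and one column have two zeros, every cell of the cycle must lie in both, which
   leaves a single cell. *)

(** * Cycles, triangles and squares in a finite simple graph *)

Section FiniteGraph.
Variables (V : finType) (e : rel V).
Hypotheses (e_sym : symmetric e) (e_irr : irreflexive e).

Lemma adj_neq x y : e x y -> x != y.
Proof. by apply: contraTneq => ->; rewrite e_irr. Qed.

(** After rotating the cycle so that [x] comes first, the two neighbours are its successor and the
    last vertex; they differ because a cycle has more than two vertices. *)
Lemma graph_cycle_neighbours s x : graph_cycle e s -> x \in s ->
  exists y z, [/\ y \in s, z \in s, y != z, e x y & e x z].
Proof.
case=> /andP[cyc_s uniq_s] s_gt2 /rot_to[i s' def_s].
have mem_s t : (t \in s) = (t \in x :: s') by rewrite -def_s mem_rot.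
move: cyc_s uniq_s s_gt2 mem_s.
rewrite -(rot_cycle i) -(rot_uniq i) -(size_rot i) def_s.
case: s' {def_s} => [|y [|z s']] //= /andP[exy /andP[_]].
rewrite rcons_path => /andP[_ elast] /and3P[_ y_nots _] _ mem_s.
exists y, (last z s'); split; rewrite ?mem_s //.
- by rewrite !inE eqxx orbT.
- by rewrite 2!inE mem_last !orbT.
- by apply: contraNneq y_nots => ->; apply: mem_last.
by rewrite e_sym.
Qed.

Lemma triangle_girth x y z : e x y -> e y z -> e z x -> girth_eq e 3.
Proof.
move=> exy eyz ezx; split; last by move=> s [].
exists [:: x; y; z] => //; split=> //.
rewrite /ucycle /= exy eyz ezx /= !inE negb_or.
by rewrite (adj_neq exy) (adj_neq eyz) eq_sym (adj_neq ezx).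
Qed.

Lemma girth3_triangle s : graph_cycle e s -> size s = 3 ->
  exists x y z, [/\ e x y, e y z & e z x].
Proof.
case=> /andP[cyc_s _] _; case: s cyc_s => [|x [|y [|z []]]] //=.
by case/and4P=> exy eyz ezx _ _; exists x, y, z.
Qed.

Lemma square_cycle x y z t : e x y -> e y z -> e z t -> e t x ->
  x != z -> y != t -> graph_cycle e [:: x; y; z; t].
Proof.
move=> exy eyz ezt etx xz yt; split=> //.
rewrite /ucycle /= exy eyz ezt etx /= !inE !negb_or.
by rewrite (adj_neq exy) (adj_neq eyz) (adj_neq ezt) xz yt eq_sym (adj_neq etx).
Qed.

End FiniteGraph.

(** * Zero patterns of boolean matrices *)

Section ZeroPatterns.
Variables (I Lam : finType).
Implicit Type M : Lam -> I -> bool.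

Definition row_zeros M l : {set I} := [set i | ~~ M l i].

Definition double_rows M : bool :=
  1 < #|[set l | 1 < #|row_zeros M l|]|.

Lemma double_rowsP M :
  reflect (exists l m, [/\ 1 < #|row_zeros M l|, 1 < #|row_zeros M m| & l != m])
    (double_rows M).
Proof.
by apply: (iffP card_gt1P) => -[l [m [l2 m2 lm]]]; exists l, m; move: l2 m2;
  rewrite !inE.
Qed.

Lemma lr_submx_tuple k n (Q : 'M[bool]_(k, n)) M (f : k.-tuple Lam)
    (g : n.-tuple I) :
  uniq f -> uniq g -> (forall a b, Q a b = M (tnth f a) (tnth g b)) ->
  lr_submx Q M.
Proof.
by move=> /tuple_uniqP f_inj /tuple_uniqP g_inj QM; exists (tnth f), (tnth g).
Qed.

(** Every statement about columns is obtained from the one about rows by passing to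
    [fun i l => M l i]; this lemma carries submatrices across. *)
Lemma lr_submx_tr k n (Q : 'M[bool]_(k, n)) M :
  lr_submx Q^T M <-> lr_submx Q (fun i l => M l i).
Proof.
split=> -[f [g [f_inj g_inj QM]]]; exists g, f; split=> // a b.
  by rewrite -QM mxE.
by rewrite mxE QM.
Qed.

Lemma O_mx_tr k n : ((O_mx k n)^T = O_mx n k)%R.
Proof. by apply/matrixP=> a b; rewrite !mxE. Qed.

Lemma O13P M : lr_submx (O_mx 1 3) M <-> exists l, 2 < #|row_zeros M l|.
Proof.
split=> [[f [g [_ g_inj QM]]] | [l /card_gt2P[i [j [k [[li lj lk] [ij jk ki]]]]]]].
  exists (f ord0); rewrite -[3]card_ord -cardsT -(card_imset _ g_inj).
  by apply/subset_leq_card/subsetP=> _ /imsetP[b _ ->]; rewrite inE -QM mxE.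
move: li lj lk; rewrite !inE => /negbTE li /negbTE lj /negbTE lk.
apply: (lr_submx_tuple (f := [tuple l]) (g := [tuple i; j; k])) => //=.
  by rewrite !inE negb_or ij jk eq_sym ki.
by move=> [[|a] ha] // [[|[|[|b]]] hb] //; rewrite mxE.
Qed.

(** [lr_submx] is a [Prop]; counting the zeros of each row gives the boolean test behind this case
    split. *)
Lemma O13_dec M : lr_submx (O_mx 1 3) M \/ ~ lr_submx (O_mx 1 3) M.
Proof.
case: (boolP [exists l, 2 < #|row_zeros M l|]) => [/existsP | /existsP] noM.
  by left; apply/O13P.
by right=> /O13P.
Qed.

Lemma O22_intro M l m i j : l != m -> i != j ->
  ~~ M l i -> ~~ M l j -> ~~ M m i -> ~~ M m j -> lr_submx (O_mx 2 2) M.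
Proof.
move=> lm ij /negbTE li /negbTE lj /negbTE mi /negbTE mj.
apply: (lr_submx_tuple (f := [tuple l; m]) (g := [tuple i; j])) => /=.
- by rewrite !inE lm.
- by rewrite !inE ij.
by move=> [[|[|a]] ha] // [[|[|b]] hb] //; rewrite mxE.
Qed.

Lemma D3_intro M (l1 l2 l3 : Lam) (i1 i2 i3 : I) :
  [/\ l1 != l2, l1 != l3 & l2 != l3] -> [/\ i1 != i2, i1 != i3 & i2 != i3] ->
  [/\ M l1 i1, M l2 i2 & M l3 i3] ->
  [/\ ~~ M l1 i2, ~~ M l1 i3 & ~~ M l2 i3] ->
  [/\ ~~ M l2 i1, ~~ M l3 i1 & ~~ M l3 i2] -> lr_submx (D_mx 3) M.
Proof.
move=> [l12 l13 l23] [i12 i13 i23] [m11 m22 m33].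
move=> [/negbTE m12 /negbTE m13 /negbTE m23] [/negbTE m21 /negbTE m31 /negbTE m32].
apply: (lr_submx_tuple (f := [tuple l1; l2; l3]) (g := [tuple i1; i2; i3])) => /=.
- by rewrite !inE negb_or l12 l13 l23.
- by rewrite !inE negb_or i12 i13 i23.
by move=> [[|[|[|a]]] ha] // [[|[|[|b]]] hb] //; rewrite mxE.
Qed.

Lemma AB_double_rows M :
  lr_submx A_mx M \/ lr_submx B_mx M -> double_rows M.
Proof.
have gt1 l i j : i != j -> ~~ M l i -> ~~ M l j -> 1 < #|row_zeros M l|.
  by move=> ij li lj; apply/card_gt1P; exists i, j; rewrite !inE.
case=> -[f [g [f_inj g_inj QM]]]; apply/double_rowsP;
  exists (f 0%R), (f 1%R); rewrite (inj_eq f_inj); split=> //.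
(* The zeros used are in columns 0, 1 and 2, 3 of the two rows of [A_mx], and in columns 0, 1 and 1,
   2 of those of [B_mx]. *)
- by apply: (gt1 _ (g (inord 0)) (g (inord 1)));
    rewrite -?QM ?mxE ?inordK // (inj_eq g_inj) -val_eqE /= !inordK.
- by apply: (gt1 _ (g (inord 2)) (g (inord 3)));
    rewrite -?QM ?mxE ?inordK // (inj_eq g_inj) -val_eqE /= !inordK.
- by apply: (gt1 _ (g (inord 0)) (g (inord 1)));
    rewrite -?QM ?mxE ?inordK // (inj_eq g_inj) -val_eqE /= !inordK.
- by apply: (gt1 _ (g (inord 1)) (g (inord 2)));
    rewrite -?QM ?mxE ?inordK // (inj_eq g_inj) -val_eqE /= !inordK.
Qed.

Lemma row_zeros_third M l i j k : ~ lr_submx (O_mx 1 3) M ->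
  i != j -> k != i -> k != j -> ~~ M l i -> ~~ M l j -> M l k.
Proof.
move=> noO13 ij ki kj li lj; case lk: (M l k) => //; case: noO13; apply/O13P.
exists l; apply/card_gt2P; exists i, j, k; rewrite !inE li lj lk ij ki.
by rewrite eq_sym kj.
Qed.

(** Without [O_mx 1 3], two such rows have exactly two zeros each. Sharing no zero column they form
    [A_mx], sharing one [B_mx], sharing both [O_mx 2 2]. *)
Lemma double_rows_AB M :
  double_rows M -> [\/ lr_submx (O_mx 1 3) M, lr_submx (O_mx 2 2) M,
    lr_submx A_mx M | lr_submx B_mx M].
Proof.
case: (O13_dec M) => [|noO13]; first by constructor.
case/double_rowsP=> l [m [/card_gt1P[i [i' [+ + ii']]] /card_gt1P[j [j' [+ + jj']]] lm]].
rewrite !inE => li li' mj mj'.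
(* Here [b] is the shared zero column and [a] the other zero column of row [l]; [c], the other one
   of row [m], is whichever of [j], [j'] differs from [b]. *)
have B_case a b : a != b -> ~~ M l a -> ~~ M l b -> M m a -> ~~ M m b ->
    lr_submx B_mx M.
  move=> ab la lb ma mb.
  have [c cb mc]: exists2 c, c != b & ~~ M m c.
    by case: (eqVneq j b) jj' => [-> | jb _]; [exists j' | exists j]; rewrite // eq_sym.
  have ca: c != a by apply: contraNneq mc => ->.
  have lc: M l c by apply: (row_zeros_third noO13 ab).
  move: la lb mb mc => /negbTE la /negbTE lb /negbTE mb /negbTE mc.
  apply: (lr_submx_tuple (f := [tuple l; m]) (g := [tuple a; b; c])) => /=.
  - by rewrite !inE lm.
  - by rewrite !inE negb_or ab eq_sym ca eq_sym cb.
  by move=> [[|[|x]] hx] // [[|[|[|y]]] hy] //; rewrite mxE.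
case mi: (M m i); case mi': (M m i').
- have [ji ji' j'i j'i'] : [/\ j != i, j != i', j' != i & j' != i'].
    by split; [move: mj | move: mj | move: mj' | move: mj'];
      apply: contraNneq => ->.
  have lj: M l j by apply: (row_zeros_third noO13 ii').
  have lj': M l j' by apply: (row_zeros_third noO13 ii').
  constructor 3; move: li li' mj mj' => /negbTE li /negbTE li' /negbTE mj /negbTE mj'.
  apply: (lr_submx_tuple (f := [tuple l; m]) (g := [tuple i; i'; j; j'])) => /=.
  - by rewrite !inE lm.
  - by rewrite !inE !negb_or ii' jj' !(eq_sym i) !(eq_sym i') ji ji' j'i j'i'.
  by move=> [[|[|x]] hx] // [[|[|[|[|y]]]] hy] //; rewrite mxE.
- by constructor 4; apply: (B_case i i'); rewrite ?mi'.
- by constructor 4; apply: (B_case i' i); rewrite ?mi // eq_sym.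
by constructor 2; apply: (O22_intro lm ii'); rewrite ?mi ?mi'.
Qed.

End ZeroPatterns.

Lemma O31P (I Lam : finType) (M : Lam -> I -> bool) :
  lr_submx (O_mx 3 1) M <-> lr_submx (O_mx 1 3) (fun i l => M l i).
Proof. by rewrite -(O_mx_tr 1 3); apply: lr_submx_tr. Qed.

Lemma O22_tr (I Lam : finType) (M : Lam -> I -> bool) :
  lr_submx (O_mx 2 2) M <-> lr_submx (O_mx 2 2) (fun i l => M l i).
Proof. by rewrite -{1}(O_mx_tr 2 2); apply: lr_submx_tr. Qed.

(** * Adjacency of cells and families of cells with two neighbours *)

Section Cells.
Variables (I Lam : finType).
Implicit Types (M : Lam -> I -> bool) (C : I * Lam -> Prop).

(** The cell [(i, l)] stands for the triple [(i, 1, l)], so its column comes first, whereas [M]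
    takes the row first. Adjacency says that both products vanish. *)
Definition cell_adj M : rel (I * Lam) :=
  fun u v => [&& u != v, ~~ M u.2 v.1 & ~~ M v.2 u.1].

(** The property of the vertex set of a cycle from which the zero patterns are extracted. *)
Definition two_neighbours M C := forall u, C u ->
  exists v w, [/\ C v, C w, v != w, cell_adj M u v & cell_adj M u w].

(** A neighbour [(j, m)] puts zeros at [(l, j)] and [(m, i)]. Two distinct neighbours differ in
    their column, giving two zeros in row [l], or in their row, giving two in column [i]. *)
Lemma two_neighbours_double M C i l : two_neighbours M C -> C (i, l) ->
  1 < #|row_zeros M l| \/ 1 < #|row_zeros (fun i l => M l i) i|.
Proof.
move=> CC /CC[[j m] [[k n] [_ _ vw /and3P[_ /= lj mi] /and3P[_ /= lk ni]]]].
case: (eqVneq j k) vw => [-> | jk _].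
  rewrite xpair_eqE eqxx /= => mn.
  by right; apply/card_gt1P; exists m, n; rewrite !inE.
by left; apply/card_gt1P; exists j, k; rewrite !inE.
Qed.

Lemma double_row_double_col M C i l : two_neighbours M C ->
  ~ lr_submx (O_mx 1 3) M -> ~~ double_rows M ->
  ~~ double_rows (fun i l => M l i) ->
  C (i, l) -> 1 < #|row_zeros M l| -> 1 < #|row_zeros (fun i l => M l i) i|.
Proof.
move=> CC noO13 rowU colU Cu l2; rewrite ltnNge; apply/negP=> i1.
case: (CC _ Cu) => [[j m] [[k n] [Cv Cw vw /and3P[uv /= lj mi] /and3P[uw /= lk ni]]]].
(* With at most one zero in column [i], both neighbours lie in the same row [m], hence in distinct
   columns [j] and [k]. *)
have mn: m = n by apply: (card_le1_eqP i1); rewrite inE.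
case: _ / mn in Cw vw uw ni.
have jk: j != k by apply: contraNneq vw => ->.
(* If [m = l], row [l] has the three zeros [i], [j], [k]. Otherwise row [m] is not a second row with
   two zeros, so columns [j] and [k] both have two. *)
case: (eqVneq m l) => [ml | ml].
  case: _ / ml in Cu l2 uv uw lj lk.
  have: M m i.
    apply: (row_zeros_third noO13 jk) => //.
    - by apply: contraNneq uv => ->.
    - by apply: contraNneq uw => ->.
  by rewrite (negbTE mi).
have m1: ~ 1 < #|row_zeros M m|.
  by move=> m2; case/double_rowsP: rowU; exists m, l.
case: (two_neighbours_double CC Cv) => // j2.
case: (two_neighbours_double CC Cw) => // k2.
by case/double_rowsP: colU; exists j, k.
Qed.

End Cells.

Lemma cell_adj_tr (I Lam : finType) (M : Lam -> I -> bool) i l j m :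
  cell_adj (fun i l => M l i) (l, i) (m, j) = cell_adj M (i, l) (j, m).
Proof.
by rewrite /cell_adj /= !xpair_eqE [(l == m) && _]andbC [~~ M m i && _]andbC.
Qed.

Lemma two_neighbours_tr (I Lam : finType) (M : Lam -> I -> bool)
    (C : I * Lam -> Prop) :
  two_neighbours M C ->
  two_neighbours (fun i l => M l i) (fun u => C (u.2, u.1)).
Proof.
move=> CC [l i] /= /CC[[j m] [[k n] [Cv Cw vw uv uw]]].
exists (m, j), (n, k); rewrite !(cell_adj_tr M); split=> //.
by apply: contraNneq vw => -[-> ->].
Qed.

Lemma two_neighbours_double_rows (I Lam : finType) (M : Lam -> I -> bool)
    (C : I * Lam -> Prop) u :
  two_neighbours M C -> C u ->
  ~ lr_submx (O_mx 1 3) M -> ~ lr_submx (O_mx 3 1) M ->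
  double_rows M || double_rows (fun i l => M l i).
Proof.
move=> CC Cu noO13 noO31; apply: contraT; rewrite negb_or => /andP[rowU colU].
have noO13t: ~ lr_submx (O_mx 1 3) (fun i l => M l i) by move/O31P.
have CCt := two_neighbours_tr CC.
have Cdouble i l : C (i, l) ->
    1 < #|row_zeros M l| /\ 1 < #|row_zeros (fun i l => M l i) i|.
  move=> Cil; case: (two_neighbours_double CC Cil) => [l2 | i2]; split=> //.
    exact: (double_row_double_col CC noO13 rowU colU Cil).
  exact: (double_row_double_col CCt noO13t colU rowU Cil).
(* Every cell of [C] lies in the only row and the only column with two zeros, so a cell coincides
   with its neighbour. *)
case: u Cu => [i l] Cil; case: (CC _ Cil) => [[j m] [_ [Cjm _ _ /andP[/negP[]] ]]].
have [l2 i2] := Cdouble _ _ Cil; have [m2 j2] := Cdouble _ _ Cjm.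
have lm: l = m.
  by apply/eqP; apply: contraNT rowU => lm; apply/double_rowsP; exists l, m.
have ij: i = j.
  by apply/eqP; apply: contraNT colU => ij; apply/double_rowsP; exists i, j.
by rewrite lm ij.
Qed.

(** * Triangles of cells *)

Lemma triangle_same_col (I Lam : finType) (M : Lam -> I -> bool) i l1 l2 v :
  cell_adj M (i, l1) (i, l2) -> cell_adj M (i, l2) v -> cell_adj M v (i, l1) ->
  lr_submx (O_mx 3 1) M \/ lr_submx (O_mx 2 2) M.
Proof.
case: v => j m /and3P[/= l12 z1 z2] /and3P[/= ul2 z2j zm] /and3P[/= ul1 _ z1j].
have {}l12: l1 != l2 by apply: contraNneq l12 => ->.
(* A third cell in another column [j] completes a zero square on rows [l1], [l2]; in the same column
   it gives a third zero of column [i]. *)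
case: (eqVneq i j) => [ij | ij]; last first.
  by right; apply: (O22_intro l12 ij).
case: _ / ij in ul1 ul2 z1j z2j.
left; apply/O31P/O13P; exists i; apply/card_gt2P; exists l1, l2, m.
rewrite !inE; split=> //; split=> //.
  by apply: contraNneq ul2 => ->.
by apply: contraNneq ul1 => ->.
Qed.

Lemma triangle_same_row (I Lam : finType) (M : Lam -> I -> bool) i1 i2 l v :
  cell_adj M (i1, l) (i2, l) -> cell_adj M (i2, l) v -> cell_adj M v (i1, l) ->
  lr_submx (O_mx 1 3) M \/ lr_submx (O_mx 2 2) M.
Proof.
case: v => j m; rewrite -!(cell_adj_tr M) => uv vw wu.
have [/O31P | /O22_tr] := triangle_same_col uv vw wu; first by left.
by right.
Qed.

Lemma triangle_submx (I Lam : finType) (M : Lam -> I -> bool) u v w :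
  cell_adj M u v -> cell_adj M v w -> cell_adj M w u ->
  [\/ lr_submx (D_mx 3) M, lr_submx (O_mx 1 3) M, lr_submx (O_mx 3 1) M
    | lr_submx (O_mx 2 2) M].
Proof.
case: (O13_dec M) => [|noO13]; first by constructor.
move: u v w => [i1 l1] [i2 l2] [i3 l3] uv vw wu.
have colE i i' l l' x : cell_adj M (i, l) (i', l') -> cell_adj M (i', l') x ->
    cell_adj M x (i, l) -> i != i' \/
    (lr_submx (O_mx 3 1) M \/ lr_submx (O_mx 2 2) M).
  case: (eqVneq i i') => [<- | _] e1 e2 e3; [right | by left].
  exact: (triangle_same_col e1 e2 e3).
have rowE i i' l l' x : cell_adj M (i, l) (i', l') -> cell_adj M (i', l') x ->
    cell_adj M x (i, l) -> l != l' \/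
    (lr_submx (O_mx 1 3) M \/ lr_submx (O_mx 2 2) M).
  case: (eqVneq l l') => [<- | _] e1 e2 e3; [right | by left].
  exact: (triangle_same_row e1 e2 e3).
have [i12|[]] := colE _ _ _ _ _ uv vw wu; try by constructor.
have [i23|[]] := colE _ _ _ _ _ vw wu uv; try by constructor.
have [i31|[]] := colE _ _ _ _ _ wu uv vw; try by constructor.
have [l12|[]] := rowE _ _ _ _ _ uv vw wu; try by constructor.
have [l23|[]] := rowE _ _ _ _ _ vw wu uv; try by constructor.
have [l31|[]] := rowE _ _ _ _ _ wu uv vw; try by constructor.
case/and3P: uv vw wu => _ /= z12 z21 /and3P[_ /= z23 z32] /and3P[_ /= z31 z13].
have [i13 l13] : i1 != i3 /\ l1 != l3 by split; rewrite eq_sym.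
have [i21 i32] : i2 != i1 /\ i3 != i2 by split; rewrite eq_sym.
(* The three cells now lie in distinct rows and columns, and adjacency makes all off-diagonal
   entries zero. A zero on the diagonal would be a third zero in its row. *)
constructor 1; apply: (@D3_intro _ _ _ l1 l2 l3 i1 i2 i3); split=> //.
- exact: (row_zeros_third noO13 i23).
- exact: (row_zeros_third noO13 i13).
exact: (row_zeros_third noO13 i12).
Qed.

(** * Vertices and edges of the commuting graph *)

Section ReesGraph.
Variables (gT : finGroupType) (I Lam : finType) (P : Lam -> I -> option gT).
Hypotheses (P_reg : regular_mx P) (P_zero : exists l i, P l i = None).
Local Notation Gamma := (@commuting_graph (rees0 P)).
Local Notation M := (mx_bar P).

(** If [(i, x, l)] is central and the entry at [l j] is non-zero, comparing its products with
    [(j, 1, m)] forces [m = l] for every [m]. With a single row, the column of a zero entry would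
    vanish, against regularity. *)
Lemma rees0_noncentral a : Some a \notin sg_center (rees0 P).
Proof.
case: a => [[i x] l]; rewrite inE; apply/negP => /forallP cent.
have [j] := P_reg.1 l; case lj: (P l j) => [p|] // _.
have lE m : m = l.
  have /eqP := cent (Some (j, 1%g, m)); rewrite /= lj.
  by case: (P m i) => // q [].
have [l0 [i0 z]] := P_zero; have [m] := P_reg.2 i0.
by rewrite (lE m) -(lE l0) z.
Qed.

Definition rees0_vertex a : cg_vertex (rees0 P) :=
  exist _ (Some a) (rees0_noncentral a).
Local Notation vtx := rees0_vertex.

Lemma rees0_vertexP x : exists a, x = vtx a.
Proof.
case def_x: (val x) => [a|]; first by exists a; apply: val_inj.
case/negP: (valP x); rewrite def_x inE; apply/forallP => -[[[i y] l]|] //=.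
Qed.

Lemma GammaE a b : Gamma (vtx a) (vtx b) =
  (a != b) && (rees0_mul P (Some a) (Some b) == rees0_mul P (Some b) (Some a)).
Proof. by []. Qed.

Lemma Gamma_zeros i x l j y m : (i, x, l) != (j, y, m) ->
  ~~ M l j -> ~~ M m i -> Gamma (vtx (i, x, l)) (vtx (j, y, m)).
Proof.
move=> ne; rewrite /mx_bar !negbK => /eqP lj /eqP mi.
by rewrite GammaE ne /= lj mi.
Qed.

Lemma Gamma_cells i x l j y m : Gamma (vtx (i, x, l)) (vtx (j, y, m)) ->
  ~~ M l j /\ ~~ M m i \/ (i, l) = (j, m).
Proof.
rewrite GammaE /mx_bar /= => /andP[_].
case: (P l j) => [p|]; case: (P m i) => [q|] //; last by left.
by case/eqP=> -> _ ->; right.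
Qed.

(* When [p] is the entry at [l i], the element [(i, p^-1, l)] is the identity
   of the group of all elements of its cell. *)
Lemma Gamma_idempotent i l : exists x, forall y, x != y ->
  Gamma (vtx (i, x, l)) (vtx (i, y, l)).
Proof.
case li: (P l i) => [p|].
  exists p^-1%g => y xy; rewrite GammaE /= li mulVg mul1g mulgK eqxx andbT.
  by rewrite !xpair_eqE !eqxx andbT.
exists 1%g => y xy; apply: Gamma_zeros; rewrite /mx_bar ?li //.
by rewrite !xpair_eqE !eqxx andbT.
Qed.

(** * Cycles over a non-trivial group *)

Lemma rees0_girth_ge3 : 2 < #|gT| -> girth_eq Gamma 3.
Proof.
case/card_gt2P=> x [y [z [_ [xy yz zx]]]]; have [l [i li]] := P_zero.
(* All products within the cell of a zero entry vanish, so that cell is a clique of size [#|gT|]. *)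
have adj u v : u != v -> Gamma (vtx (i, u, l)) (vtx (i, v, l)).
  by move=> uv; apply: Gamma_zeros; rewrite /mx_bar ?li // !xpair_eqE !eqxx andbT.
exact: (triangle_girth (@commuting_graph_irrefl _) (adj _ _ xy) (adj _ _ yz)
  (adj _ _ zx)).
Qed.

Lemma two_zeros_girth3 : 1 < #|gT| -> 1 < #|zero_entries P| ->
  girth_eq Gamma 3.
Proof.
case/card_gt1P=> g [h [_ _ gh]] /card_gt1P[[l i] [[m j] []]].
rewrite !inE /= => /eqP li /eqP mj ne.
case: (eqVneq i j) => [ij | ij].
  case: _ / ij in mj ne; have {}ne: l != m by apply: contraNneq ne => ->.
  apply: (triangle_girth (@commuting_graph_irrefl _) (x := vtx (i, g, l))
    (y := vtx (i, h, l)) (z := vtx (i, g, m)));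
  by apply: Gamma_zeros; rewrite /mx_bar ?li ?mj // !xpair_eqE ?(negbTE gh)
    ?(negbTE ne) ?andbF // eq_sym (negbTE ne) andbF.
(* For zeros in distinct columns, [(j, g, l)] annihilates the whole cell [(i, m)] on both sides, so
   two commuting elements of that cell complete a triangle. *)
have [x idx] := Gamma_idempotent i m.
have [y xy]: exists y, x != y.
  by case: (eqVneq x g) gh => [->|]; [exists h | exists g].
apply: (triangle_girth (@commuting_graph_irrefl _) (idx _ xy)
  (z := vtx (j, g, l)));
  by apply: Gamma_zeros; rewrite /mx_bar ?li ?mj // !xpair_eqE
    ?(negbTE ij) // eq_sym (negbTE ij).
Qed.

Lemma cycle_two_zeros s : #|gT| = 2 -> graph_cycle Gamma s ->
  1 < #|zero_entries P|.
Proof.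
move=> G2 cyc_s; have x0: exists x, x \in s.
  by case: s cyc_s => [[]|x s] //; exists x; rewrite inE eqxx.
have [l0 [i0 z0]] := P_zero; rewrite ltnNge; apply/negP=> /card_le1_eqP zU.
have cellE l i : ~~ M l i -> (l, i) = (l0, i0).
  by rewrite /mx_bar negbK => li; apply: zU; rewrite !inE //= z0.
(* With a unique zero entry, two zero products already force both elements into its cell, so every
   edge stays inside one cell. *)
have adjE i x l j y m : Gamma (vtx (i, x, l)) (vtx (j, y, m)) ->
    [/\ i = j, l = m & x != y].
  move=> e; have [ij lm]: i = j /\ l = m.
    case: (Gamma_cells e) => [[/cellE lj /cellE mi] | [] //].
    by case: lj mi => -> -> [-> ->].
  split=> //; move: e; rewrite ij lm GammaE => /andP[+ _].
  by apply: contraNneq => ->.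
case: x0 => u s_u.
have [v [w [_ _ vw]]] := graph_cycle_neighbours (@commuting_graph_sym _) cyc_s s_u.
case: (rees0_vertexP u) (rees0_vertexP v) (rees0_vertexP w) vw
  => [[[i x] l] ->] [[[j y] m] ->] [[[k z] n] ->] vw.
case/adjE=> ij lm xy /adjE[ik ln xz].
suff: 2 < #|gT| by rewrite G2.
apply/card_gt2P; exists x, y, z; split=> //; split=> //; last by rewrite eq_sym.
by apply: contraNneq vw => ->; rewrite -ij -lm ik ln.
Qed.

(** * The trivial group, where vertices are cells *)

Section TrivialGroup.
Hypothesis G1 : #|gT| = 1.

Lemma trivial_group (x : gT) : x = 1%g.
Proof. by apply: (card_le1_eqP (A := gT)) => //; rewrite G1. Qed.

Definition cell_vertex (u : I * Lam) := vtx (u.1, 1%g, u.2).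

Lemma cell_vertexP x : exists u, x = cell_vertex u.
Proof.
have [[[i y] l] ->] := rees0_vertexP x.
by exists (i, l); rewrite (trivial_group y).
Qed.

Lemma Gamma_cell_vertex u v : Gamma (cell_vertex u) (cell_vertex v) = cell_adj M u v.
Proof.
case: u v => [i l] [j m]; apply/idP/and3P => [e | [/= uv lj mi]].
  have uv: (i, l) != (j, m).
    by move: e; rewrite GammaE => /andP[+ _]; apply: contraNneq => -[-> ->].
  by case: (Gamma_cells e) => [[lj mi] | uv_eq] //; case/eqP: uv.
by apply: Gamma_zeros => //; apply: contraNneq uv => -[-> ->].
Qed.

Lemma cell_triangle_girth u v w :
  cell_adj M u v -> cell_adj M v w -> cell_adj M w u -> girth_eq Gamma 3.
Proof.
rewrite -!Gamma_cell_vertex; exact: triangle_girth (@commuting_graph_irrefl _) _ _ _.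
Qed.

Lemma girth3_submx s : graph_cycle Gamma s -> size s = 3 ->
  [\/ lr_submx (D_mx 3) M, lr_submx (O_mx 1 3) M, lr_submx (O_mx 3 1) M
    | lr_submx (O_mx 2 2) M].
Proof.
move=> cyc_s s3; have [x [y [z]]] := girth3_triangle cyc_s s3.
case: (cell_vertexP x) (cell_vertexP y) (cell_vertexP z) => [u ->] [v ->] [w ->].
by rewrite !Gamma_cell_vertex => -[]; apply: triangle_submx.
Qed.

(** Cells in row [m] at the zero columns of row [l] are joined to cells in row [l] at the zero
    columns of row [m]; the square alternates between the two kinds. *)
Lemma double_rows_square : double_rows M ->
  exists2 s, graph_cycle Gamma s & size s = 4.
Proof.
case/double_rowsP=> l [m [/card_gt1P[i [i' [+ + ii']]] /card_gt1P[j [j' [+ + jj']]] lm]].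
rewrite !inE => li li' mj mj'.
exists [seq cell_vertex u | u <- [:: (i, m); (j, l); (i', m); (j', l)]] => //.
apply: square_cycle; rewrite ?Gamma_cell_vertex /cell_adj ?xpair_eqE /=
  ?li ?li' ?mj ?mj' ?(negbTE lm) 1?[m == l]eq_sym ?(negbTE lm) ?andbF //.
- exact: (@commuting_graph_irrefl (rees0 P)).
- by apply: contraNneq ii' => -[->].
by apply: contraNneq jj' => -[->].
Qed.

Lemma double_cols_square : double_rows (fun i l => M l i) ->
  exists2 s, graph_cycle Gamma s & size s = 4.
Proof.
case/double_rowsP=> i [j [/card_gt1P[l [l' [+ + ll']]] /card_gt1P[m [m' [+ + mm']]] ij]].
rewrite !inE => li li' mj mj'.
exists [seq cell_vertex u | u <- [:: (i, m); (j, l); (i, m'); (j, l')]] => //.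
apply: square_cycle; rewrite ?Gamma_cell_vertex /cell_adj ?xpair_eqE /=
  ?li ?li' ?mj ?mj' ?(negbTE ij) 1?[j == i]eq_sym ?(negbTE ij) ?andbF //.
- exact: (@commuting_graph_irrefl (rees0 P)).
- by apply: contraNneq mm' => -[->].
by apply: contraNneq ll' => -[->].
Qed.

Lemma cycle_double_rows s : graph_cycle Gamma s ->
  ~ lr_submx (O_mx 1 3) M -> ~ lr_submx (O_mx 3 1) M ->
  double_rows M || double_rows (fun i l => M l i).
Proof.
move=> cyc_s.
have [x s_x]: exists x, x \in s.
  by case: s cyc_s => [[]|x s] //; exists x; rewrite inE eqxx.
have [u def_x] := cell_vertexP x; rewrite {}def_x in s_x.
apply: (two_neighbours_double_rows (C := fun u => cell_vertex u \in s) _ s_x).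
move=> {s_x}u s_u.
have [v [w]] := graph_cycle_neighbours (@commuting_graph_sym _) cyc_s s_u.
case: (cell_vertexP v) (cell_vertexP w) => [v' ->] [w' ->].
rewrite !Gamma_cell_vertex => -[sv sw vw uv uw]; exists v', w'; split=> //.
by apply: contraNneq vw => ->.
Qed.

Lemma O13_girth3 : lr_submx (O_mx 1 3) M -> girth_eq Gamma 3.
Proof.
case/O13P=> l /card_gt2P[i [j [k []]]]; rewrite !inE => -[li lj lk] [ij jk ki].
apply: (cell_triangle_girth (u := (i, l)) (v := (j, l)) (w := (k, l)));
  by rewrite /cell_adj xpair_eqE /= ?(negbTE ij) ?(negbTE jk) ?(negbTE ki) ?li ?lj ?lk.
Qed.

Lemma O31_girth3 : lr_submx (O_mx 3 1) M -> girth_eq Gamma 3.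
Proof.
case/O31P/O13P=> i /card_gt2P[l [m [n []]]]; rewrite !inE => -[li mi ni] [lm mn nl].
apply: (cell_triangle_girth (u := (i, l)) (v := (i, m)) (w := (i, n)));
  by rewrite /cell_adj xpair_eqE /= ?(negbTE lm) ?(negbTE mn) ?(negbTE nl)
    ?andbF ?li ?mi ?ni.
Qed.

Lemma O22_girth3 : lr_submx (O_mx 2 2) M -> girth_eq Gamma 3.
Proof.
case=> f [g [f_inj g_inj QM]].
have z a b : ~~ M (f a) (g b) by rewrite -QM mxE.
(* The four cells of the zero square are pairwise adjacent; three of them are taken. *)
apply: (cell_triangle_girth (u := (g 0%R, f 0%R)) (v := (g 0%R, f 1%R))
  (w := (g 1%R, f 0%R)));
  by rewrite /cell_adj /= !z xpair_eqE (inj_eq f_inj) (inj_eq g_inj).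
Qed.

Lemma D3_girth3 : lr_submx (D_mx 3) M -> girth_eq Gamma 3.
Proof.
case=> f [g [f_inj g_inj QM]].
have adj a b : a != b -> cell_adj M (g a, f a) (g b, f b).
  move=> ab; rewrite /cell_adj /= -!QM !mxE [b == a]eq_sym ab xpair_eqE.
  by rewrite (inj_eq f_inj) (negbTE ab) andbF.
exact: (cell_triangle_girth (adj 0%R 1%R isT) (adj 1%R ord_max isT)
  (adj ord_max 0%R isT)).
Qed.

End TrivialGroup.
End ReesGraph.

(** * The three cases by the order of the group *)

Theorem theorem6p2 (gT : finGroupType) (I Lam : finType)
    (P : Lam -> I -> option gT) (I_gt0 : 0 < #|I|) (Lam_gt0 : 0 < #|Lam|)
    (P_reg : regular_mx P) (P_zero : exists l i, P l i = None) :
  let Gamma := @commuting_graph (rees0 P) in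
  let sub k n (Q : 'M[bool]_(k, n)) := lr_submx Q (mx_bar P) in
  let girth3_sub :=
    [\/ sub _ _ (D_mx 3), sub _ _ (O_mx 1 3), sub _ _ (O_mx 3 1)
      | sub _ _ (O_mx 2 2)] in
  let girth4_sub :=
    [\/ sub _ _ A_mx, sub _ _ A_mx^T%R, sub _ _ B_mx | sub _ _ B_mx^T%R] in
  [/\ 3 <= #|gT| -> contains_cycles Gamma /\ girth_eq Gamma 3,
      #|gT| = 2 ->
        (contains_cycles Gamma <-> 1 < #|zero_entries P|) /\
        (contains_cycles Gamma -> girth_eq Gamma 3)
    & #|gT| = 1 ->
        [/\ contains_cycles Gamma <-> girth3_sub \/ girth4_sub,
            girth3_sub -> girth_eq Gamma 3
          & girth4_sub /\ ~ girth3_sub -> girth_eq Gamma 4]].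
Proof.
move=> Gamma sub girth3_sub girth4_sub.
have girth_cycles n : girth_eq Gamma n -> contains_cycles Gamma.
  by case=> -[s cyc_s _] _; exists s.
split=> [G3 | G2 | G1].
- have g3 := rees0_girth_ge3 P_reg P_zero G3.
  by split=> //; apply: girth_cycles g3.
- have two_zeros : contains_cycles Gamma -> 1 < #|zero_entries P|.
    by case=> s; apply: cycle_two_zeros.
  have g3 : 1 < #|zero_entries P| -> girth_eq Gamma 3.
    by apply: two_zeros_girth3; rewrite ?G2.
  split; last by move/two_zeros.
  by split=> // /g3/girth_cycles.
have sub3 : girth3_sub -> girth_eq Gamma 3.
  by case; [apply: D3_girth3 | apply: O13_girth3 | apply: O31_girth3
    | apply: O22_girth3].
have sub4 : girth4_sub -> exists2 s, graph_cycle Gamma s & size s = 4.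
  case=> [sA | sA | sB | sB].
  - by apply: double_rows_square => //; apply: AB_double_rows; left.
  - apply: double_cols_square => //; apply: AB_double_rows; left.
    exact/lr_submx_tr.
  - by apply: double_rows_square => //; apply: AB_double_rows; right.
  - apply: double_cols_square => //; apply: AB_double_rows; right.
    exact/lr_submx_tr.
split=> // [|[/sub4 s4 no3]].
  split=> [[s cyc_s] | [/sub3/girth_cycles // | /sub4[s cyc_s _]]]; last by exists s.
  case: (O13_dec (mx_bar P)) => [|noO13]; first by left; constructor.
  case: (O13_dec (fun i l => mx_bar P l i)) => [/O31P | noO31].
    by left; constructor.
  have noO31' : ~ lr_submx (O_mx 3 1) (mx_bar P) by move/O31P.
  (* Two double rows are classified directly, two double columns through the transpose, where the
     [O_mx 1 3] case is excluded by [noO31]. *)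
  case/orP: (cycle_double_rows P_reg P_zero G1 cyc_s noO13 noO31') => /double_rows_AB[].
  - by left; constructor.
  - by left; constructor.
  - by right; constructor.
  - by right; constructor.
  - by [].
  - by move/O22_tr; left; constructor.
  - by move/lr_submx_tr; right; constructor.
  - by move/lr_submx_tr; right; constructor.
(* A cycle of length below 4 is a triangle, which would yield one of the patterns excluded by
   [no3]. *)
split=> // s cyc_s; rewrite leqNgt; apply/negP => s_lt4; apply: no3.
apply: (girth3_submx P_reg P_zero G1 cyc_s).
by apply/eqP; rewrite eqn_leq -ltnS s_lt4; case: cyc_s.
Qed.
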